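(* Let $G$ be a connected cubic graph with $n$ vertices and $m$ edges, where $m$ is even. Then the number $p(M(G))$ of perfect matchings of the vertex-edge graph $M(G)$ satisfies $$p(M(G))=2^{m-n+1}3^{\frac{2n-m}{2}}=2^{\frac{n}{2}+1}3^{\frac{n}{4}}.$$
   Context: Graphs are finite and simple. A cubic graph is a graph in which every vertex has degree $3$. For a graph $G$ with vertex set $V(G)$ and edge set $E(G)$, the line graph $L(G)$ has vertex set $E(G)$, two distinct edges of $G$ being adjacent in $L(G)$ if they share an endpoint in $G$. The vertex-edge graph (also called the middle graph) $M(G)$ of $G$ has vertex set $V(G)\cup E(G)$ (disjoint union) and edge set $E(L(G))\cup\{ue,ve : e=uv\in E(G)\}$; that is, two elements of $E(G)$ are adjacent in $M(G)$ if they share an endpoint in $G$, each $e=uv\in E(G)$ is adjacent to its two endpoints $u$ and $v$, and no two elements of $V(G)$ are adjacent. A perfect matching (dimer covering) of a graph is a set of edges such that every vertex is incident with exactly one edge of the set. For a graph $H$, $p(H)$ denotes the number of perfect matchings of $H$. *)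

(* Defs.v *)
From mathcomp Require Import all_boot.

Set Implicit Arguments.
Unset Strict Implicit.
Unset Printing Implicit Defensive.

Record sgraph := SGraph {
  vertex :> finType;
  adj : rel vertex;
  adj_sym : symmetric adj;
  adj_irrefl : irreflexive adj
}.

Definition edges (G : sgraph) : {set {set G}} :=
  [set [set x; y] | x in G, y in G & adj x y].

Definition edge (G : sgraph) : finType := {A : {set G} | A \in edges G}.

Definition degree (G : sgraph) (x : G) : nat := #|[set y | adj x y]|.

Definition cubic (G : sgraph) : Prop := forall x : G, degree x = 3.

(* The graph without vertices is not considered connected. *)
Definition connected (G : sgraph) : Prop :=
  0 < #|G| /\ forall x y : G, connect (@adj G) x y.

Definition line_adj (G : sgraph) : rel (edge G) :=
  fun e f => (e != f) && (val e :&: val f != set0).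

Lemma line_adj_sym (G : sgraph) : symmetric (@line_adj G).
Proof. by move=> e f; rewrite /line_adj eq_sym setIC. Qed.

Lemma line_adj_irrefl (G : sgraph) : irreflexive (@line_adj G).
Proof. by move=> e; rewrite /line_adj eqxx. Qed.

Definition line_graph (G : sgraph) : sgraph :=
  SGraph (@line_adj_sym G) (@line_adj_irrefl G).

Definition middle_adj (G : sgraph) : rel (G + edge G) :=
  fun a b => match a, b with
  | inl _, inl _ => false
  | inl v, inr e => v \in val e
  | inr e, inl v => v \in val e
  | inr e, inr f => @adj (line_graph G) e f
  end.

Lemma middle_adj_sym (G : sgraph) : symmetric (@middle_adj G).
Proof. by move=> [v|e] [w|f] //=; exact: line_adj_sym. Qed.

Lemma middle_adj_irrefl (G : sgraph) : irreflexive (@middle_adj G).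
Proof. by move=> [v|e] //=; exact: line_adj_irrefl. Qed.

Definition middle_graph (G : sgraph) : sgraph :=
  SGraph (@middle_adj_sym G) (@middle_adj_irrefl G).

Definition perfect_matching (H : sgraph) (M : {set {set H}}) : bool :=
  (M \subset edges H) && [forall v : H, #|[set e in M | v \in e]| == 1].

Definition num_perfect_matchings (H : sgraph) : nat :=
  #|[set M : {set {set H}} | perfect_matching M]|.

(* Main.v *)
(** The middle graph of a cubic graph is an edge-disjoint union of copies of K4,
    one for each vertex [v] of [G], on [v] and the three edges at [v].  In a
    perfect matching every [e = uv] is matched inside the copy of [u] or inside
    that of [v], which orients [e]; the vertex [v] and the edges pointing to it
    are matched among themselves, so every in-degree is odd, i.e. 1 or 3.
    Conversely, such an orientation and the choice of a mate for each vertex [v]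
    among the edges pointing to [v] determine the matching.  With m = 6j and
    n = 4j, exactly j vertices have in-degree 3, giving 3^j choices.

    Reversing the edge [uv] toggles the parity of the in-degree at [u] and [v]
    only.  By connectivity all prescriptions of these parities away from a root
    are satisfied by equally many of the 2^m orientations; there are 2^(n-1)
    prescriptions, and the parity at the root is forced, so 2^(m-n+1)
    orientations have all in-degrees odd. *)

Require Import Defs.
From mathcomp Require Import all_boot zify.

Set Implicit Arguments.
Unset Strict Implicit.
Unset Printing Implicit Defensive.

Lemma edgesP (G : sgraph) (A : {set G}) :
  reflect (exists x y, adj x y /\ A = [set x; y]) (A \in edges G).
Proof.
apply: (iffP imset2P) => [[x y _] | [x [y [xy ->]]]].
  by rewrite inE => /andP[_ xy] ->; exists x, y.
by exists x y => //; rewrite inE.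
Qed.

Lemma adj_neq (G : sgraph) (x y : G) : adj x y -> x != y.
Proof. by apply: contraTneq => ->; rewrite adj_irrefl. Qed.

Lemma mem_edges (G : sgraph) (x y : G) : ([set x; y] \in edges G) = adj x y.
Proof.
apply/edgesP/idP => [[a [b [ab xyE]]] | xy]; last by exists x, y.
have nab := adj_neq ab.
have : a \in [set x; y] by rewrite xyE set21.
have : b \in [set x; y] by rewrite xyE set22.
rewrite !inE => /orP[] /eqP bE /orP[] /eqP aE; subst a b => //.
- by rewrite eqxx in nab.
- by rewrite adj_sym.
- by rewrite eqxx in nab.
Qed.

Lemma edges_other (G : sgraph) (A : {set G}) (x : G) :
  A \in edges G -> x \in A -> exists2 y, adj x y & A = [set x; y].
Proof.
case/edgesP => a [b [ab ->]]; rewrite !inE => /orP[] /eqP ->; first by exists b.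
by exists a; rewrite 1?adj_sym // setUC.
Qed.

(** * Perfect matchings as involutions sending each vertex to a neighbour *)

Section Mates.
Variable H : sgraph.

Definition mates : {set {ffun H -> H}} :=
  [set f : {ffun H -> H} | [forall x, adj x (f x) && (f (f x) == x)]].

Lemma matesP (f : {ffun H -> H}) :
  reflect (forall x, adj x (f x) /\ f (f x) = x) (f \in mates).
Proof.
rewrite inE; apply: (iffP forallP) => h x.
  by case/andP: (h x) => ? /eqP.
by case: (h x) => -> ->; rewrite eqxx.
Qed.

Definition matching_of (f : {ffun H -> H}) : {set {set H}} :=
  [set [set x; f x] | x in H].

(** As [f] is an involution, [y] and [f y] give rise to the same edge, so the only edge through [x]
    is the one that [x] itself contributes. *)
Lemma matching_of_mem f x A : f \in mates ->
  (A \in matching_of f) && (x \in A) = (A == [set x; f x]).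
Proof.
move=> /matesP fP; apply/andP/eqP => [[/imsetP[y _ ->]] | ->].
  by rewrite !inE => /orP[] /eqP -> //; rewrite (fP y).2 setUC.
by split; [apply/imsetP; exists x | rewrite set21].
Qed.

Lemma matching_of_perfect f : f \in mates -> perfect_matching (matching_of f).
Proof.
move=> fM; have /matesP fP := fM; apply/andP; split.
  by apply/subsetP => _ /imsetP[x _ ->]; rewrite mem_edges (fP x).1.
apply/forallP => x; apply/cards1P; exists [set x; f x].
by apply/setP => A; rewrite !inE matching_of_mem.
Qed.

Lemma matching_of_inj : {in mates &, injective matching_of}.
Proof.
move=> f g fM gM fgE; apply/ffunP => x.
have /matesP/(_ x)[/adj_neq nx _] := fM.
have : [set x; f x] == [set x; g x].
  by rewrite -matching_of_mem // -fgE matching_of_mem // eqxx.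
move=> /eqP/setP/(_ (f x)); rewrite !inE eqxx orbT => /esym/orP[] /eqP // e.
by rewrite e eqxx in nx.
Qed.

Lemma matching_of_surj M :
  perfect_matching M -> exists2 f, f \in mates & M = matching_of f.
Proof.
case/andP => /subsetP ME /forallP Mx.
have hex x : exists y, [set A in M | x \in A] = [set [set x; y]].
  have /cards1P[A AE] := Mx x.
  have : A \in [set A in M | x \in A] by rewrite AE set11.
  rewrite inE => /andP[AM xA].
  by have [y _ yE] := edges_other (ME _ AM) xA; exists y; rewrite AE yE.
have [f0 f0P] := fin_all_exists hex.
pose f : {ffun H -> H} := [ffun x => f0 x].
have fP x A : (A \in M) && (x \in A) = (A == [set x; f x]).
  by move/setP/(_ A): (f0P x); rewrite !inE ffunE.
have fM x : [set x; f x] \in M.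
  by have := fP x [set x; f x]; rewrite eqxx => /andP[].
have fadj x : adj x (f x) by rewrite -mem_edges ME.
have fmates : f \in mates.
  apply/matesP => x; split => //.
  (* The matching edge through [f x] is unique, so [{x, f x}] equals [{f x, f (f x)}]; hence [x] is
     [f x] or [f (f x)], and the former would be a loop. *)
  have := fP (f x) [set x; f x]; rewrite fM set22 => /esym/eqP/setP/(_ x).
  rewrite !inE eqxx /= => /esym/orP[] /eqP // e.
  by have := adj_neq (fadj x); rewrite -e eqxx.
exists f => //; apply/setP => A; apply/idP/imsetP => [AM | [x _ ->]//].
have /edgesP[x [y [_ AE]]] := ME _ AM.
by exists x => //; apply/eqP; rewrite -fP AM AE set21.
Qed.

Lemma num_perfect_matchingsE : num_perfect_matchings H = #|mates|.
Proof.
rewrite -(card_in_imset matching_of_inj); apply: eq_card => M; rewrite inE.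
apply/idP/imsetP => [/matching_of_surj[f fM ->] | [f fM ->]]; first by exists f.
exact: matching_of_perfect.
Qed.

End Mates.

(** * Orientations and the parities of their in-degrees *)

Section Orientations.
Variable G : sgraph.
Implicit Types (o : {ffun edge G -> G}) (e : edge G) (u v w : G).

Definition edge_of u v (uv : adj u v) : edge G :=
  exist _ [set u; v] (etrans (mem_edges u v) uv).

(** An orientation is encoded by the head of each edge. *)
Definition orientations : {set {ffun edge G -> G}} :=
  [set o : {ffun edge G -> G} | [forall e : edge G, o e \in val e]].

Lemma orientationP o :
  reflect (forall e, o e \in val e) (o \in orientations).
Proof. by rewrite inE; apply: forallP. Qed.

Definition into o v : {set edge G} := [set e : edge G | o e == v].

Definition incident v : {set edge G} := [set e : edge G | v \in val e].

Lemma card_edge : #|edge G| = #|edges G|.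
Proof. by rewrite card_sig; apply: eq_card => A; rewrite inE. Qed.

Lemma edge_card2 e : #|val e| = 2.
Proof.
by case/edgesP: (valP e) => x [y [xy ->]]; rewrite cards2 adj_neq.
Qed.

(** Two distinct common endpoints would exhaust both edges and make them equal. *)
Lemma edge_common e f u v : e != f ->
  u \in val e -> u \in val f -> v \in val e -> v \in val f -> u = v.
Proof.
move=> nef ue uf ve vf; apply: contraNeq nef => nuv; apply/eqP/val_inj.
have sub (h : edge G) : u \in val h -> v \in val h -> [set u; v] = val h.
  move=> uh vh; apply/eqP; rewrite eqEcard edge_card2 cards2 nuv andbT.
  by apply/subsetP => x; rewrite !inE => /orP[] /eqP ->.
by rewrite -(sub e) // -(sub f).
Qed.

Lemma card_incident v : #|incident v| = degree v.
Proof.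
have sub : [set [set v; y] | y in [set y | adj v y]] = [set val e | e in incident v].
  apply/setP => A; apply/imsetP/imsetP => [[y] | [e]].
    rewrite inE => vy ->; exists (edge_of vy) => //.
    by rewrite inE /= set21.
  rewrite inE => /(edges_other (valP e))[y vy eE] ->.
  by exists y; rewrite ?inE.
have <- := card_imset (mem (incident v)) val_inj.
rewrite -sub card_in_imset // => y z; rewrite !inE => vy _ /setP/(_ y).
rewrite !inE eqxx orbT => /esym/orP[] /eqP // yv.
by have := adj_neq vy; rewrite yv eqxx.
Qed.

Lemma handshake : \sum_(v : G) degree v = 2 * #|edges G|.
Proof.
transitivity (\sum_(v : G) \sum_(e : edge G) (v \in val e : nat)).
  apply: eq_bigr => v _; rewrite -card_incident -sum1_card big_mkcond.
  by apply: eq_bigr => e _; rewrite inE; case: ifP.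
rewrite exchange_big /= -card_edge mulnC -sum_nat_const.
apply: eq_bigr => e _; rewrite -(edge_card2 e) -sum1_card [RHS]big_mkcond.
by apply: eq_bigr => v _; case: ifP.
Qed.

Lemma sum_into o : \sum_(v : G) #|into o v| = #|edges G|.
Proof.
transitivity (\sum_(v : G) \sum_e (o e == v : nat)).
  apply: eq_bigr => v _; rewrite -sum1_card big_mkcond.
  by apply: eq_bigr => e _; rewrite inE; case: ifP.
rewrite exchange_big /= -card_edge -sum1_card.
apply: eq_bigr => e _; rewrite (bigD1 (o e)) //= eqxx big1 // => v.
by rewrite eq_sym => /negbTE ->.
Qed.

Lemma into_sub_incident o v : o \in orientations -> into o v \subset incident v.
Proof.
by move=> /orientationP oO; apply/subsetP => e; rewrite !inE => /eqP <-.
Qed.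

Lemma card_orientations : #|orientations| = 2 ^ #|edges G|.
Proof.
have -> : #|orientations| = #|family (fun e => mem (val e))|.
  by apply: eq_card => o; rewrite inE; apply/forallP/familyP.
rewrite card_family foldrE big_map big_enum (eq_bigr (fun=> 2)) => [|e _].
  by rewrite prod_nat_const card_edge.
exact: edge_card2.
Qed.

Definition flip u v (e0 : edge G) o : {ffun edge G -> G} :=
  [ffun e => if e == e0 then if o e == u then v else u else o e].

(** The root [r] is left alone, in accordance with [odd_off], which does not record the parity at
    [r]. *)
Definition toggle (r v : G) (S : {set G}) : {set G} :=
  [set x | (x \in S) (+) ((x == v) && (x != r))].

Definition odd_off (r : G) o : {set G} := [set v | (v != r) && odd #|into o v|].

Lemma toggleK r v : involutive (toggle r v).
Proof. by move=> S; apply/setP => x; rewrite !inE -addbA addbb addbF. Qed.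

Lemma toggleC r u v S : toggle r u (toggle r v S) = toggle r v (toggle r u S).
Proof. by apply/setP => x; rewrite !inE -!addbA [(_ && _) (+) _]addbC. Qed.

Lemma toggle_root r S : toggle r r S = S.
Proof. by apply/setP => x; rewrite !inE andbN addbF. Qed.

Lemma odd_into o v : odd #|into o v| = \big[addb/false]_e (o e == v).
Proof.
rewrite -sum1_card big_mkcond /=.
rewrite (big_morph odd oddD (erefl : odd 0 = false)).
by apply: eq_bigr => e _; rewrite inE; case: ifP.
Qed.

Section Flip.
Variables (u v : G) (uv : adj u v).
Let e0 := edge_of uv.

Lemma flip_orientation o :
  o \in orientations -> flip u v e0 o \in orientations.
Proof.
move=> /orientationP oO; apply/orientationP => e; rewrite ffunE.
case: (e =P e0) => [-> | _ //]; rewrite [val _]/=.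
by case: ifP; rewrite !inE eqxx ?orbT.
Qed.

Lemma flipK : {in orientations, involutive (flip u v e0)}.
Proof.
move=> o /orientationP oO; apply/ffunP => e; rewrite !ffunE.
case: (e =P e0) => // ->; have := oO e0; rewrite !inE.
have := adj_neq uv; rewrite eq_sym => /negbTE nvu.
by case: (o e0 =P u) => [-> | _ /= /eqP ->]; rewrite ?nvu ?eqxx.
Qed.

Lemma odd_off_flip r o : o \in orientations ->
  odd_off r (flip u v e0 o) = toggle r u (toggle r v (odd_off r o)).
Proof.
move=> /orientationP oO; apply/setP => x; rewrite !inE !odd_into.
rewrite (bigD1 e0) //= [in RHS](bigD1 e0) //= ffunE eqxx.
under eq_bigr => e /negbTE ne do rewrite ffunE ne.
(* [b] is the contribution of the edges other than [e0], which the flip does not change. *)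
move: (\big[_/_]_(_ | _) _) => b.
have nuv := adj_neq uv; have nvu := nuv; rewrite eq_sym in nvu.
have := oO e0; rewrite !inE !(eq_sym x) => /orP[] /eqP ->;
  rewrite ?eqxx ?(negbTE nvu).
all: by case: (u == x); case: (v == x); case: (r == x); case: b.
Qed.

End Flip.

Definition fibre r S : {set {ffun edge G -> G}} :=
  [set o in orientations | odd_off r o == S].

(** Reversing [uv] injects each fibre into the toggled one. Toggling twice restores the set, so the
    same inequality at the toggled set is the converse. *)
Lemma fibre_adj r u v S : adj u v ->
  #|fibre r (toggle r u (toggle r v S))| = #|fibre r S|.
Proof.
move=> uv.
have le T : #|fibre r T| <= #|fibre r (toggle r u (toggle r v T))|.
  have inj : {in fibre r T &, injective (flip u v (edge_of uv))}.
    move=> o o' /setIdP[oO _] /setIdP[oO' _] h.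
    by rewrite -(flipK uv oO) h flipK.
  rewrite -(card_in_imset inj); apply/subset_leq_card/subsetP => _ /imsetP[o + ->].
  case/setIdP => oO /eqP <-; apply/setIdP.
  by rewrite flip_orientation // odd_off_flip.
apply/eqP; rewrite eqn_leq le andbT.
by have := le (toggle r u (toggle r v S));
  rewrite [toggle r v (toggle r u _)]toggleC !toggleK.
Qed.

(** Along a path every inner vertex is toggled twice, so only the two ends count. *)
Lemma fibre_connect r u v S : connect (@adj G) u v ->
  #|fibre r (toggle r u (toggle r v S))| = #|fibre r S|.
Proof.
case/connectP => p; elim: p u => [|w p IHp] u /=.
  by move=> _ ->; rewrite toggleK.
case/andP => uw pw vE; rewrite -(IHp w) // -(fibre_adj r _ uw).
by rewrite [toggle r w (toggle r w _)]toggleK.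
Qed.

(** Toggling at [r] has no effect, so a path from [v] to [r] allows a single [v] to be removed from
    [S]; the elements of [S] are removed one by one. *)
Lemma card_fibre r (S : {set G}) : (forall v, connect (@adj G) v r) ->
  S \subset [set~ r] -> #|fibre r S| = #|fibre r set0|.
Proof.
move=> conn; have [k] := ubnP #|S|; elim: k S => // k IHk S.
case: (set_0Vmem S) => [-> // | [v vS]] Sk SE.
have := subsetP SE v vS; rewrite !inE => vr.
rewrite -(fibre_connect r S (conn v)) toggle_root.
have -> : toggle r v S = S :\ v.
  apply/setP => x; rewrite !inE; case: (x =P v) => [-> | _] /=.
    by rewrite vS vr.
  by rewrite addbF.
apply: IHk; last exact: subset_trans (subD1set _ _) SE.
by move: Sk; rewrite (cardsD1 v) vS.
Qed.

Lemma odd_off_sub r o : odd_off r o \subset [set~ r].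
Proof. by apply/subsetP => x; rewrite !inE => /andP[]. Qed.

Lemma mul_card_fibre r (S : {set G}) : (forall v, connect (@adj G) v r) ->
  S \subset [set~ r] -> 2 ^ #|G|.-1 * #|fibre r S| = 2 ^ #|edges G|.
Proof.
move=> conn SE; rewrite -card_orientations -[#|orientations|]sum1_card.
rewrite (partition_big (odd_off r) [in powerset [set~ r]]) /=; last first.
  by move=> o _; rewrite powersetE odd_off_sub.
rewrite (eq_bigr (fun=> #|fibre r S|)) => [|T]; last first.
  rewrite powersetE => TE; rewrite (card_fibre conn SE) -(card_fibre conn TE).
  by rewrite -sum1_card; apply: eq_bigl => o; rewrite !inE.
by rewrite sum_nat_const card_powerset cardsC1.
Qed.

Definition odd_orientations : {set {ffun edge G -> G}} :=
  [set o in orientations | [forall v, odd #|into o v|]].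

Lemma card_odd_orientations : connected G -> odd #|G| = odd #|edges G| ->
  2 ^ #|G|.-1 * #|odd_orientations| = 2 ^ #|edges G|.
Proof.
case=> G0 conn par; have /card_gt0P[r _] := G0.
rewrite -(mul_card_fibre (r := r) (S := [set~ r])) //.
congr (_ * _); apply: eq_card => o; rewrite !inE; apply: andb_id2l => oO.
have sumE := sum_into o; rewrite (bigD1 r) //= in sumE.
apply/forallP/eqP => [h | /setP h v].
  by apply/setP => v; rewrite !inE h andbT.
have hv w : w != r -> odd #|into o w| by have := h w; rewrite !inE => + wr;
  rewrite wr.
(* The in-degrees sum to m, which has the parity of n; as the other n-1 of them are odd, so is the
   one at [r]. *)
have [-> | /hv //] := eqVneq v r.
have := congr1 odd sumE; rewrite oddD -par (big_morph odd oddD (erefl : odd 0 = false)).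
rewrite (eq_bigr (fun=> odd 1)) => [|w /hv -> //].
rewrite -(big_morph odd oddD (erefl : odd 0 = false)) sum1_card.
rewrite (eq_card (_ : _ =i predC1 r)) // cardC1.
case: #|G| G0 => //= k _; case: (odd #|into o r|) => //=; by case: (odd k).
Qed.

(* [o e] is the vertex whose copy of K4 contains [e] and its mate; [g v] is the
   mate of [v]. *)
Definition cubic_codes :
    {set {ffun edge G -> G} * {ffun G -> edge G}} :=
  [set og : {ffun edge G -> G} * {ffun G -> edge G} |
    (og.1 \in odd_orientations) && [forall v, og.1 (og.2 v) == v]].

Lemma card_cubic_codes :
  #|cubic_codes| = \sum_(o in odd_orientations) \prod_(v : G) #|into o v|.
Proof.
rewrite -sum1_card (eq_bigl (fun og : {ffun edge G -> G} * {ffun G -> edge G} =>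
  (og.1 \in odd_orientations) && (og.2 \in family (fun v => mem (into og.1 v))))).
  rewrite -(pair_big_dep [in odd_orientations]
    (fun o g => g \in family (fun v => mem (into o v))) (fun _ _ => 1)) /=.
  apply: eq_bigr => o _; rewrite sum1_card card_family foldrE big_map.
  by rewrite big_enum.
move=> [o g]; rewrite inE; congr (_ && _) => /=.
by apply/forallP/familyP => h v; have := h v; rewrite inE.
Qed.

Definition mate_of (og : {ffun edge G -> G} * {ffun G -> edge G}) :
    {ffun middle_graph G -> middle_graph G} :=
  let: (o, g) := og in
  [ffun z : G + edge G => match z with
    | inl v => inr (g v)
    | inr e => if g (o e) == e then inl (o e)
      else inr (odflt e [pick f in into o (o e) :\ g (o e) :\ e])
    end].

End Orientations.

(** * Codes and perfect matchings of the middle graph of a cubic graph *)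

Section CubicCodes.
Variable G : sgraph.
Hypothesis Gcubic : cubic G.
Implicit Types (o : {ffun edge G -> G}) (g : {ffun G -> edge G}).

Lemma odd_into_cases o v :
  o \in odd_orientations G -> #|into o v| = 1 \/ #|into o v| = 3.
Proof.
case/setIdP => oO /forallP/(_ v).
have := subset_leq_card (into_sub_incident v oO).
rewrite card_incident Gcubic.
by case: #|_| => [|[|[|[|]]]] //; [left | right].
Qed.

Section Code.
Variables (o : {ffun edge G -> G}) (g : {ffun G -> edge G}).
Hypothesis ogP : (o, g) \in cubic_codes G.

Let oodd : o \in odd_orientations G.
Proof. by case/setIdP: ogP. Qed.

Lemma code_head v : o (g v) = v.
Proof. by case/setIdP: ogP => _ /forallP/(_ v)/eqP. Qed.

Lemma mate_vertex v : mate_of (o, g) (inl v) = inr (g v).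
Proof. by rewrite ffunE. Qed.

Lemma mate_chosen_edge e : g (o e) = e -> mate_of (o, g) (inr e) = inl (o e).
Proof. by move=> ge; rewrite ffunE ge eqxx. Qed.

(** [e] and [g (o e)] are two edges pointing to [o e], so the in-degree there is not 1 but 3. *)
Lemma third_edge e : g (o e) != e ->
  exists f, into o (o e) :\ g (o e) :\ e = [set f].
Proof.
move=> ge; apply/cards1P.
have := cardsD1 (g (o e)) (into o (o e)).
rewrite [_ \in into _ _]inE code_head eqxx.
have := cardsD1 e (into o (o e) :\ g (o e)).
rewrite in_setD1 [e == _]eq_sym ge [e \in _]inE eqxx.
by case: (odd_into_cases (o e) oodd) => ->; lia.
Qed.

Lemma mate_other_edge e f : f != e -> g (o e) != e -> g (o e) != f ->
  o f = o e -> mate_of (o, g) (inr e) = inr f.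
Proof.
move=> nfe ge gf ofe; rewrite ffunE (negbTE ge).
have [f' f'E] := third_edge ge; rewrite f'E.
have : f \in [set f'] by rewrite -f'E !inE nfe eq_sym gf ofe eqxx.
rewrite inE => /eqP <-.
by case: pickP => [h | /(_ f)]; rewrite inE ?eqxx // => /eqP ->.
Qed.

Lemma other_edge e : g (o e) != e ->
  exists f, [/\ f != e, g (o e) != f & o f = o e].
Proof.
move=> ge; have [f /setP/(_ f)] := third_edge ge.
rewrite !inE eqxx => /and3P[nfe nfg /eqP ofe].
by exists f; split; rewrite // eq_sym.
Qed.

Lemma mate_of_mates : mate_of (o, g) \in mates (middle_graph G).
Proof.
have oO : forall e, o e \in val e by apply/orientationP; case/setIdP: oodd.
apply/matesP => -[v | e].
  rewrite mate_vertex mate_chosen_edge ?code_head //; split => //=.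
  by rewrite -{1}(code_head v).
have [ge | ge] := eqVneq (g (o e)) e.
  by rewrite mate_chosen_edge // mate_vertex ge; split => /=.
have [f [nfe gf ofe]] := other_edge ge.
rewrite (mate_other_edge nfe) // (mate_other_edge (e := f) (f := e)) ?ofe //; last first.
  by rewrite eq_sym.
split=> //=; rewrite /line_adj eq_sym nfe /=.
by apply/set0Pn; exists (o e); rewrite inE oO -ofe oO.
Qed.

End Code.

(** The mates of the vertices give [g]. An edge chosen by [g] has its head prescribed; any other has
    an edge as its mate, and its head is their only common endpoint. *)
Lemma mate_of_inj : {in cubic_codes G &, injective (@mate_of G)}.
Proof.
move=> [o g] [o' g'] ogP og'P eqM.
have gE : g = g'.
  apply/ffunP => v; have := congr1 (fun f : {ffun _ -> _} => f (inl v)) eqM.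
  by rewrite !mate_vertex => -[].
subst g'; congr (_, _); apply/ffunP => e.
have oO : forall e, o e \in val e.
  by apply/orientationP; case/setIdP: ogP => /setIdP[].
have oO' : forall e, o' e \in val e.
  by apply/orientationP; case/setIdP: og'P => /setIdP[].
have [ge | ge] := eqVneq (g (o e)) e.
  by rewrite -{2}ge (code_head og'P).
have [ge' | ge'] := eqVneq (g (o' e)) e.
  by rewrite -{1}ge' (code_head ogP).
have [f [nfe gf ofe]] := other_edge ogP ge.
have [f' [nfe' gf' ofe']] := other_edge og'P ge'.
have ff' : f = f'.
  have := congr1 (fun f : {ffun _ -> _} => f (inr e)) eqM.
  by rewrite (mate_other_edge ogP nfe) // (mate_other_edge og'P nfe') // => -[].
subst f'; apply: (edge_common nfe); rewrite // -?ofe ?oO //.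
by rewrite -ofe' oO'.
Qed.

Lemma mate_of_surj f : f \in mates (middle_graph G) ->
  exists2 og, og \in cubic_codes G & f = mate_of og.
Proof.
move=> fM; have /matesP fP := fM.
have hg (v : G) : exists e : edge G, f (inl v) = inr e.
  by have [+ _] := fP (inl v); case: (f (inl v)) => [w | e] // _; exists e.
(* The head of [e] is its mate, if that is a vertex, and otherwise an endpoint shared with its
   mate. *)
have ho (e : edge G) : exists v : G, v \in val e /\
    match f (inr e) with inl w => w = v | inr e' => v \in val e' end.
  have [+ _] := fP (inr e); case: (f (inr e)) => [w | e'] /=; first by exists w.
  by rewrite /line_adj => /andP[_ /set0Pn[v /setIP[]]]; exists v.
have [g0 g0P] := fin_all_exists hg; have [o0 o0P] := fin_all_exists ho.
pose g : {ffun G -> edge G} := [ffun v => g0 v].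
pose o : {ffun edge G -> G} := [ffun e => o0 e].
have gP v : f (inl v) = inr (g v) by rewrite ffunE.
have oO e : o e \in val e by rewrite ffunE; case: (o0P e).
have oP e : match f (inr e) with inl w => w = o e | inr e' => o e \in val e' end.
  by rewrite ffunE; have [_] := o0P e; case: (f (inr e)).
have fK z : f (f z) = z by case: (fP z).
have fgP v : f (inr (g v)) = inl v by rewrite -gP fK.
have ogv v : o (g v) = v by have := oP (g v); rewrite fgP.
have ov e v : f (inr e) = inl v -> g v = e.
  by move=> h; have := gP v; rewrite -h fK => -[].
have oe e e' : f (inr e) = inr e' -> [/\ e' != e, o e' = o e & f (inr e') = inr e].
  move=> h; have h' : f (inr e') = inr e by rewrite -h fK.
  have nee : e' != e by have := fP (inr e); rewrite h => -[/andP[]]; rewrite eq_sym.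
  (* The heads of [e] and [e'] were picked separately, but both are common endpoints of these
     distinct edges. *)
  have := oP e; have := oP e'; rewrite h h' => a b.
  by split=> //; apply: (edge_common nee); rewrite ?oO.
(* An edge pointing to [v] other than [g v] is mated to another such edge, so
   there are exactly three edges pointing to [v] unless there is only one. *)
have odd_o v : odd #|into o v|.
  have gin : g v \in into o v by rewrite inE ogv.
  have := subset_leq_card (into_sub_incident v (introT (orientationP _) oO)).
  rewrite card_incident Gcubic (cardsD1 (g v)) gin.
  case: (set_0Vmem (into o v :\ g v)) => [-> | [e]]; first by rewrite cards0.
  move=> ein; rewrite (cardsD1 e) ein.
  move: ein; rewrite !inE => /andP[neg /eqP oev].
  case fe: (f (inr e)) => [w | e'].
    by have := oP e; rewrite fe oev => wv; rewrite -(ov _ _ fe) wv eqxx in neg.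
  have [nee' oe' fe'] := oe _ _ fe.
  rewrite (cardsD1 e') (_ : e' \in _) ?inE ?nee' ?oe' ?oev ?eqxx ?andbT /=; last first.
    by apply/eqP => ge'; have := fgP v; rewrite -ge' fe'.
  by case: #|_| => [|[]].
have ogP : (o, g) \in cubic_codes G.
  apply/setIdP; split; last by apply/forallP => v /=; rewrite ogv.
  by apply/setIdP; split; [apply/orientationP | apply/forallP].
exists (o, g) => //; apply/ffunP => -[v | e]; first by rewrite mate_vertex.
case fe: (f (inr e)) => [w | e'].
  have := oP e; rewrite fe => wE; subst w.
  by rewrite mate_chosen_edge // (ov _ _ fe).
have [nee' oe' fe'] := oe _ _ fe.
rewrite (mate_other_edge ogP nee') //.
- by apply/eqP => h; have := fgP (o e); rewrite h fe.
- by apply/eqP => h; have := fgP (o e); rewrite h fe'.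
Qed.

Lemma num_perfect_matchings_middle :
  num_perfect_matchings (middle_graph G) = #|cubic_codes G|.
Proof.
rewrite num_perfect_matchingsE -(card_in_imset mate_of_inj).
apply: eq_card => f; apply/idP/imsetP => [/mate_of_surj[og ogP ->] | [[o g] ogP ->]].
  by exists og.
exact: mate_of_mates.
Qed.

(** With [b v] indicating in-degree 3, the in-degree at [v] is both [1 + 2 * b v] and [3 ^ b v]: the
    sum m of the first form shows that [k] vertices have in-degree 3, and the second gives the
    product. *)
Lemma prod_into o k : o \in odd_orientations G ->
  #|edges G| = #|G| + 2 * k -> \prod_(v : G) #|into o v| = 3 ^ k.
Proof.
move=> oodd mE; pose b v := #|into o v| == 3.
have bE v : #|into o v| = 3 ^ b v /\ #|into o v| = 1 + 2 * b v.
  by rewrite /b; case: (odd_into_cases v oodd) => ->.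
rewrite (eq_bigr (fun v : G => 3 ^ b v)) => [|v _]; last by case: (bE v).
rewrite -expn_sum; congr (3 ^ _).
have := sum_into o; rewrite (eq_bigr (fun v : G => 1 + 2 * b v)) => [|v _]; last first.
  by case: (bE v).
rewrite big_split -big_distrr /= sum1_card mE => /eqP.
by rewrite eqn_add2l eqn_mul2l => /eqP.
Qed.

End CubicCodes.

(* For a cubic graph 3n = 2m, so if m is even then 4 divides n and n <= m <= 2n:
   no subtraction or division below is truncated. *)
Theorem theorem1p4 (G : sgraph) (n m : nat)
    (Hn : #|G| = n) (Hm : #|edges G| = m)
    (Gconn : connected G) (Gcubic : cubic G) (m_even : ~~ odd m) :
  num_perfect_matchings (middle_graph G)
    = 2 ^ (m - n + 1) * 3 ^ ((2 * n - m) %/ 2)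
  /\ 2 ^ (m - n + 1) * 3 ^ ((2 * n - m) %/ 2)
    = 2 ^ (n %/ 2 + 1) * 3 ^ (n %/ 4).
Proof.
have nm : n * 3 = 2 * m.
  by rewrite -Hm -handshake -Hn -sum_nat_const; apply: eq_bigr => v _; rewrite Gcubic.
have n0 : 0 < n by rewrite -Hn; case: Gconn.
have [j [nE mE]] : exists j, n = 4 * j /\ m = 6 * j by exists (n %/ 4); lia.
have -> : m - n + 1 = 2 * j + 1 by lia.
have -> : (2 * n - m) %/ 2 = j by lia.
have -> : n %/ 2 = 2 * j by lia.
have -> : n %/ 4 = j by lia.
split=> //; rewrite num_perfect_matchings_middle // card_cubic_codes.
rewrite (eq_bigr (fun=> 3 ^ j)) => [|o oodd]; last first.
  by apply: prod_into; rewrite // Hm Hn; lia.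
rewrite sum_nat_const; congr (_ * _).
have : odd #|G| = odd #|edges G| by rewrite Hn Hm nE mE !oddM.
move/(card_odd_orientations Gconn); rewrite Hn Hm => /eqP.
(* Splitting off [n.-1] in the exponent lets the factor counting the parity prescriptions cancel. *)
have -> : m = n.-1 + (2 * j + 1) by lia.
by rewrite expnD eqn_pmul2l ?expn_gt0 // => /eqP.
Qed.
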